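(* Let $\mathcal F$ be a group pair with $A$ as in the context, and let $(x,y),(y,z)\in\mathcal E$, so that also $(x,z)\in\mathcal E$. Put $M=\varphi_{xy}^{-1}[K_{xy}\circ H_{yz}]$; this is a normal subgroup of $G_x$. The following are equivalent: (i) the relation $R_{xy,0}\,;\,R_{yz,0}$ is in $A$; (ii) for each $\alpha<\kappa_{xy}$ and each $\beta<\kappa_{yz}$, the relation $R_{xy,\alpha}\,;\,R_{yz,\beta}$ is in $A$; (iii) for each $\alpha<\kappa_{xy}$ and each $\beta<\kappa_{yz}$, $$R_{xy,\alpha}\,;\,R_{yz,\beta}=\bigcup\{R_{xz,\gamma}:\gamma<\kappa_{xz},\ H_{xz,\gamma}\subseteq\varphi_{xy}^{-1}[K_{xy,\alpha}\circ H_{yz,\beta}]\};$$ (iv) $H_{xz}\subseteq M$, and $\hat\varphi_{xy}\,;\,\hat\varphi_{yz}=\hat\varphi_{xz}$. Here $\hat\varphi_{xy}$ and $\hat\varphi_{xz}$ are the mappings induced by $\varphi_{xy}$ and $\varphi_{xz}$ on $G_x/M$, and $\hat\varphi_{yz}$ is the isomorphism induced by $\varphi_{yz}$ on $G_y/(K_{xy}\circ H_{yz})$. Consequently, $A$ is closed under relational composition if and only if (iv) holds for all pairs $(x,y),(y,z)\in\mathcal E$.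
   Context: A group pair consists of the following data. - Pairwise disjoint groups $G_x$ ($x\in I$), with operation $\circ$ and identity $e_x$. - An equivalence relation $\mathcal E$ on $I$. - For each $(x,y)\in\mathcal E$, an isomorphism $\varphi_{xy}:G_x/H_{xy}\to G_y/K_{xy}$, where $H_{xy}\trianglelefteq G_x$ and $K_{xy}\trianglelefteq G_y$. Write $X\circ Y=\{a\circ b:a\in X,b\in Y\}$. For each $(x,y)\in\mathcal E$ fix an enumeration without repetitions $\langle H_{xy,\gamma}:\gamma<\kappa_{xy}\rangle$ of the cosets of $H_{xy}$, with $H_{xy,0}=H_{xy}$, and put $K_{xy,\gamma}=\varphi_{xy}(H_{xy,\gamma})$. Define $R_{xy,\alpha}=\bigcup_{\gamma<\kappa_{xy}}H_{xy,\gamma}\times(K_{xy,\gamma}\circ K_{xy,\alpha})$. Let $A$ be the set of all unions of subfamilies of the relations $R_{xy,\alpha}$. $R\,;\,S$ denotes relational composition. Images of unions of cosets: - For $S\subseteq G_x$ a union of cosets of $H_{xy}$, $\varphi_{xy}[S]$ is the union of $\varphi_{xy}(H)$ over the cosets $H\subseteq S$. - For $T\subseteq G_y$ a union of cosets of $K_{xy}$, $\varphi_{xy}^{-1}[T]$ is the union of the cosets $H$ of $H_{xy}$ with $\varphi_{xy}(H)\subseteq T$. Induced maps: if $N$ is a normal subgroup of $G_x$ that is a union of cosets of $H_{xy}$, the map induced by $\varphi_{xy}$ on $G_x/N$ sends each coset $C$ of $N$ to $\varphi_{xy}[C]$; similarly for the other isomorphisms. For maps $f,g$, $f\,;\,g$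 means first $f$ then $g$. *)

(* Defs.v *)
From Corelib Require Export RelationClasses.
From mathcomp Require Export all_boot.
From mathcomp Require Export boolp classical_sets functions.

Set Implicit Arguments.
Unset Strict Implicit.
Unset Printing Implicit Defensive.

Local Open Scope classical_set_scope.
Local Open Scope group_scope.

Section Groups.
Variable G : groupType.
Implicit Types X Y N : set G.

Definition cprod X Y : set G := [set a * b | a in X & b in Y].

Definition normal_subgroup N : Prop :=
  group_closed (mem N) /\ forall a g, N a -> N (a ^ g).

(* The underlying set of the quotient G / N; for N normal, left and right
   cosets agree and the product of two cosets is their complex product. *)
Definition cosets N : set (set G) := [set cprod [set g] N | g in [set: G]].

End Groups.

Definition quotient_iso (G G' : groupType) (H : set G) (K : set G')
    (f : set G -> set G') : Prop :=
  set_bij (cosets H) (cosets K) f /\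
  forall X Y, cosets H X -> cosets H Y -> f (cprod X Y) = cprod (f X) (f Y).

Unset Implicit Arguments.

(* gpH, gpK and gpphi are total in x and y, but nothing is assumed about them
   when x and y are not related by gpE, and gpphi x y is only meaningful on the
   cosets of gpH x y. *)
Record group_pair := GroupPair {
  gpI : Type;
  gpG : gpI -> groupType;
  gpE : gpI -> gpI -> Prop;
  gpH : forall x y : gpI, set (gpG x);
  gpK : forall x y : gpI, set (gpG y);
  gpphi : forall x y : gpI, set (gpG x) -> set (gpG y);
  gpE_equiv : Equivalence gpE;
  gpH_normal : forall x y, gpE x y -> normal_subgroup (gpH x y);
  gpK_normal : forall x y, gpE x y -> normal_subgroup (gpK x y);
  gpphi_iso : forall x y, gpE x y ->
    quotient_iso (gpH x y) (gpK x y) (gpphi x y)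
}.

(* The index type enum_kappa x y stands for the ordinals below kappa_xy; only
   its distinguished element 0 matters, not the well-ordering. *)
Record coset_enum (F : group_pair) := CosetEnum {
  enum_kappa : gpI F -> gpI F -> Type;
  enum_zero : forall x y, enum_kappa x y;
  enum_H : forall x y, enum_kappa x y -> set (gpG F x);
  enum_H_bij : forall x y, gpE _ x y ->
    set_bij [set: enum_kappa x y] (cosets (gpH _ x y)) (enum_H x y);
  enum_H_zero : forall x y, gpE _ x y -> enum_H x y (enum_zero x y) = gpH _ x y
}.

Arguments gpG {_} x.
Arguments gpE {_} x y.
Arguments gpH {_} x y _.
Arguments gpK {_} x y _.
Arguments gpphi {_} x y _ _.
Arguments enum_kappa {F} c x y.
Arguments enum_zero {F} c x y.
Arguments enum_H {F} c {x y} _ _.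

Set Implicit Arguments.

(* First R, then S (the library's infix notation has the opposite order). *)
Definition relcomp (T1 T2 T3 : Type) (R : set (T1 * T2)) (S : set (T2 * T3)) :
  set (T1 * T3) := (S \; R)%relation.

Section Relations.
Variables (F : group_pair) (e : coset_enum F).

(* The sigma type is the union of the pairwise disjoint groups. *)
Definition gpU : Type := {x : gpI F & gpG x}.

Definition gpin (x : gpI F) (X : set (gpG x)) : set gpU :=
  existT (fun x => gpG x : Type) x @` X.

Definition enum_K (x y : gpI F) (c : enum_kappa e x y) : set (gpG y) :=
  gpphi x y (enum_H e c).

Definition gpR (x y : gpI F) (a : enum_kappa e x y) : set (gpU * gpU) :=
  \bigcup_(c in [set: enum_kappa e x y])
    (gpin (enum_H e c) `*` gpin (cprod (enum_K c) (enum_K a))).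

Definition gpatoms : set (set (gpU * gpU)) :=
  [set R | exists x y (a : enum_kappa e x y), gpE x y /\ R = gpR a].

Definition gpA : set (set (gpU * gpU)) :=
  [set \bigcup_(R in S) R | S in [set S | S `<=` gpatoms]].

End Relations.

Unset Implicit Arguments.

Section Images.
Variable F : group_pair.

Definition phi_img (x y : gpI F) (S : set (gpG x)) : set (gpG y) :=
  \bigcup_(C in [set C | cosets (gpH x y) C /\ C `<=` S]) gpphi x y C.

Definition phi_preimg (x y : gpI F) (T : set (gpG y)) : set (gpG x) :=
  \bigcup_(C in [set C | cosets (gpH x y) C /\ gpphi x y C `<=` T]) C.

(* The map induced by phi_xy on G_x / N, as the graph of a function with domain
   the cosets of N. *)
Definition induced (x y : gpI F) (N : set (gpG x)) :
    set (set (gpG x) * set (gpG y)) :=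
  [set (C, phi_img x y C) | C in cosets N].

Definition gpM (x y z : gpI F) : set (gpG x) :=
  phi_preimg x y (cprod (gpK x y) (gpH y z)).

Definition induced_comp (x y z : gpI F) : Prop :=
  gpH x z `<=` gpM x y z /\
  relcomp (induced x y (gpM x y z)) (induced y z (cprod (gpK x y) (gpH y z))) =
  induced x z (gpM x y z).

End Images.

Arguments phi_img {F} x y S _.
Arguments phi_preimg {F} x y T _.
Arguments induced {F} x y N _.
Arguments gpM {F} x y z _.
Arguments induced_comp {F} x y z.

(* Main.v *)
Require Import Defs.

(** By Goursat's lemma, [phi_xy] is the same thing as the subgroup
    [P_xy = {(p, q) | q \in phi_xy(p H_xy)}] of [G_x * G_y], which projects onto
    both factors; it is [R_xy,0], and [R_xy,a] is its translate
    [{(p, q) | P_xy (p h) q}] by any [h] in [H_xy,a].  Put [Q = P_xy ; P_yz],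
    again such a subgroup.  Then [M = {p | Q p 1}], the relation
    [R_xy,a ; R_yz,b] is a translate of [Q], and
    [phi_xy^-1[K_xy,a o H_yz,b]] is the corresponding coset of [M].  Each of the
    four conditions amounts to the inclusion of [P_xz] in [Q]: a translate of [Q]
    is a union of translates of [P_xz] exactly in this case, and the induced maps
    send [g M] to [{r | Q g r}] and to [{r | exists m in M, P_xz (g m) r}],
    respectively. *)

Set Implicit Arguments.
Unset Strict Implicit.
Unset Printing Implicit Defensive.
Local Open Scope classical_set_scope.
Local Open Scope group_scope.

(** Equality of indices need not be decidable; proof irrelevance reduces the equality of first
    components to [erefl]. *)
Lemma existT_inj2 (T : Type) (P : T -> Type) (x : T) (u v : P x) :
  existT P x u = existT P x v -> u = v.
Proof.
move=> E; have := projT2_eq E.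
by rewrite (Prop_irrelevance (projT1_eq E) (erefl x)).
Qed.

(** * Cosets of a normal subgroup *)

Section Cosets.
Variables (G : groupType) (N : set G).
Hypothesis N_normal : normal_subgroup N.
Implicit Types g h : G.

Lemma normal1 : N 1.
Proof. by case: N_normal => -[/set_mem]. Qed.

Lemma normal_div g h : N g -> N h -> N (g * h^-1).
Proof. by case: N_normal => -[_ D] _ /mem_set Ng /mem_set Nh; apply/set_mem/D. Qed.

Lemma normalV g : N g -> N g^-1.
Proof. by move=> Ng; rewrite -[g^-1]mul1g; apply: normal_div => //; exact: normal1. Qed.

Lemma normalM g h : N g -> N h -> N (g * h).
Proof. by move=> Ng Nh; rewrite -[h]invgK; apply: normal_div => //; exact: normalV. Qed.

Lemma normalJ g h : N g -> N (g ^ h).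
Proof. by case: N_normal => _; apply. Qed.

Lemma lcosetE (M : set G) g h : cprod [set g] M h <-> M (g^-1 * h).
Proof.
split=> [[_ -> [m Mm <-]]|Mgh]; first by rewrite mulKg.
by exists g => //; exists (g^-1 * h) => //; rewrite mulVKg.
Qed.

Lemma lcoset_refl g : cprod [set g] N g.
Proof. by rewrite lcosetE mulVg; exact: normal1. Qed.

Lemma lcoset1 : cprod [set 1] N = N.
Proof. by apply/seteqP; split=> h; rewrite lcosetE invg1 mul1g. Qed.

Lemma lcoset_eq g h : cprod [set g] N h -> cprod [set g] N = cprod [set h] N.
Proof.
rewrite lcosetE => Ngh; apply/seteqP; split=> k; rewrite !lcosetE => Nk.
  have -> : h^-1 * k = (g^-1 * h)^-1 * (g^-1 * k) by rewrite invgM invgK mulgA mulgK.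
  by apply: normalM => //; exact: normalV.
have -> : g^-1 * k = (g^-1 * h) * (h^-1 * k) by rewrite mulgA mulgK.
exact: normalM.
Qed.

Lemma lcosetM g h :
  cprod (cprod [set g] N) (cprod [set h] N) = cprod [set g * h] N.
Proof.
apply/seteqP; split=> [_ [a + [b + <-]]|k]; rewrite !lcosetE => Na.
  move=> Nb; have -> : (g * h)^-1 * (a * b) = (g^-1 * a) ^ h * (h^-1 * b).
    by rewrite conjgE invgM !mulgA mulgK.
  by apply: normalM => //; exact: normalJ.
exists g; first exact: lcoset_refl.
exists (g^-1 * k); last by rewrite mulVKg.
by rewrite lcosetE mulgA -invgM.
Qed.

Lemma cosets_lcoset g : cosets N (cprod [set g] N).
Proof. by exists g. Qed.

Lemma cosetsP C g : cosets N C -> C g -> C = cprod [set g] N.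
Proof. by move=> [h _ <-]; exact: lcoset_eq. Qed.

End Cosets.

(** * Subgroups of a product that project onto both factors *)

Record goursat (G G' : groupType) (P : G -> G' -> Prop) : Prop := Goursat {
  goursatM : forall p q p' q', P p q -> P p' q' -> P (p * p') (q * q');
  goursatV : forall p q, P p q -> P p^-1 q^-1;
  goursat_total : forall p, exists q, P p q;
  goursat_surj : forall q, exists p, P p q }.

Section Goursat.
Variables (G G' : groupType) (P : G -> G' -> Prop).
Hypothesis gP : goursat P.

Lemma goursat1 : P 1 1.
Proof.
have [q Pq] := goursat_total gP 1.
by have := goursatM gP Pq (goursatV gP Pq); rewrite !mulgV.
Qed.

(** Dividing two pairs with the same second entry lands in [{p | P p 1}]: the fibres over the second
    factor are left cosets of this kernel. *)
Lemma goursat_eqr p p' q : P p q -> (P p' q <-> P (p^-1 * p') 1).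
Proof.
move=> Ppq; split=> [Pp'q|].
  by have := goursatM gP (goursatV gP Ppq) Pp'q; rewrite mulVg.
by move/(goursatM gP Ppq); rewrite mulVKg mulg1.
Qed.

Lemma goursat_eql p q q' : P p q -> (P p q' <-> P 1 (q^-1 * q')).
Proof.
move=> Ppq; split=> [Pp'q|].
  by have := goursatM gP (goursatV gP Ppq) Pp'q; rewrite mulVg.
by move/(goursatM gP Ppq); rewrite mulVKg mulg1.
Qed.

Lemma goursat_ker p : P p 1 -> forall p' q, P (p' * p) q <-> P p' q.
Proof.
move=> Pp p' q; split=> [/(goursatM gP)/(_ (goursatV gP Pp))|/(goursatM gP)/(_ Pp)].
  by rewrite mulgK invg1 mulg1.
by rewrite mulg1.
Qed.

Lemma goursat_mul a b p q : P a b -> (P (p * a) (q * b) <-> P p q).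
Proof.
move=> Pab; split=> [/(goursatM gP)/(_ (goursatV gP Pab))|/(goursatM gP)/(_ Pab)] //.
by rewrite !mulgK.
Qed.

(** Every [g] is the first entry of some pair [(g, r)] in [P], and conjugating [(a, 1)] by it gives
    [(a ^ g, 1)]. *)
Lemma goursat_ker_normal : normal_subgroup [set p | P p 1].
Proof.
split=> [|a g /= Pa]; last first.
  have [r Pgr] := goursat_total gP g.
  have := goursatM gP (goursatV gP Pgr) (goursatM gP Pa Pgr).
  by rewrite conjgE mul1g mulVg.
split=> [|a b /set_mem /= Pa /set_mem /= Pb]; first exact/mem_set/goursat1.
by apply/mem_set; have := goursatM gP Pa (goursatV gP Pb); rewrite mulgV.
Qed.

End Goursat.

Definition rcomp (G1 G2 G3 : Type) (P : G1 -> G2 -> Prop) (P' : G2 -> G3 -> Prop)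
  (p : G1) (r : G3) : Prop := exists2 q, P p q & P' q r.

Lemma goursat_comp (G1 G2 G3 : groupType) (P : G1 -> G2 -> Prop)
    (P' : G2 -> G3 -> Prop) :
  goursat P -> goursat P' -> goursat (rcomp P P').
Proof.
move=> gP gP'; split.
- move=> p r p' r' [q Pq P'q] [q' Pq' P'q'].
  by exists (q * q'); [exact: goursatM Pq Pq'|exact: goursatM P'q P'q'].
- by move=> p r [q Pq P'q]; exists q^-1; apply: goursatV.
- move=> p; have [q Pq] := goursat_total gP p.
  by have [r P'q] := goursat_total gP' q; exists r; exists q.
- move=> r; have [q P'q] := goursat_surj gP' r.
  by have [p Pq] := goursat_surj gP q; exists p; exists q.
Qed.

(** * From an isomorphism of quotients to a subgroup of the product *)

Section QuotientIso.
Variables (G G' : groupType) (H : set G) (K : set G') (f : set G -> set G').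
Hypotheses (nH : normal_subgroup H) (nK : normal_subgroup K).
Hypothesis fiso : quotient_iso H K f.

Definition iso_rel (p : G) (q : G') : Prop := f (cprod [set p] H) q.

Lemma quotient_iso_fun C : cosets H C -> cosets K (f C).
Proof. by case: fiso => -[F _ _] _; exact: F. Qed.

(** [f H] is an idempotent of the quotient by [K], and a group has only one idempotent. *)
Lemma quotient_iso1 : f H = K.
Proof.
have cH : cosets H H by rewrite -{2}(lcoset1 H); exact: cosets_lcoset.
have [q _ fq] := quotient_iso_fun cH.
have HH : cprod H H = H by have := lcosetM nH 1 1; rewrite mulg1 lcoset1.
have E : cprod [set q] K = cprod [set q * q] K.
  by rewrite -(lcosetM nK) fq -fiso.2 // HH.
have Kq : K q by have := lcoset_refl nK (q * q); rewrite -E lcosetE mulKg.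
rewrite -fq -[RHS]lcoset1; apply/esym/(lcoset_eq nK).
by rewrite lcoset1.
Qed.

Lemma iso_rel1 q : iso_rel 1 q <-> K q.
Proof. by rewrite /iso_rel lcoset1 quotient_iso1. Qed.

Lemma goursat_iso_rel : goursat iso_rel.
Proof.
have M p q p' q' : iso_rel p q -> iso_rel p' q' -> iso_rel (p * p') (q * q').
  move=> Pq Pq'; rewrite /iso_rel -(lcosetM nH) fiso.2; [|exact: cosets_lcoset..].
  by exists q => //; exists q'.
have T p : exists q, iso_rel p q.
  have [q _ fq] := quotient_iso_fun (cosets_lcoset H p).
  by exists q; rewrite /iso_rel -fq; exact: lcoset_refl.
split=> // [p q Pq|q].
  (* For [q'] related to [p^-1], the product [q' * q] lies in [K]; correcting [q'] by the inverse of
     this product gives [q^-1]. *)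
  have [q' Pq'] := T p^-1.
  have := M _ _ _ _ Pq' Pq; rewrite mulVg iso_rel1 => /(normalV nK) /iso_rel1 K1.
  by have := M _ _ _ _ K1 Pq'; rewrite mul1g invgM mulgVK.
case: fiso => -[_ _ /(_ _ (cosets_lcoset K q))] [C [p _ <-] fp] _.
by exists p; rewrite /iso_rel fp; exact: lcoset_refl.
Qed.

(** If [1] lies in [f (p H)], that coset is [K = f H], and injectivity of [f] gives [p H = H]. *)
Lemma iso_rel_ker p : iso_rel p 1 <-> H p.
Proof.
split=> [Pp|Hp].
  have := cosetsP nK (quotient_iso_fun (cosets_lcoset H p)) Pp.
  rewrite lcoset1 -quotient_iso1 => E.
  have cH : cosets H H by rewrite -{2}(lcoset1 H); exact: cosets_lcoset.
  case: fiso => -[_ /(_ _ _ (mem_set (cosets_lcoset H p)) (mem_set cH) E) <- _] _.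
  exact: lcoset_refl.
rewrite /iso_rel -(@lcoset_eq _ _ nH 1) ?lcoset1 //.
by rewrite quotient_iso1; exact: normal1.
Qed.

End QuotientIso.

(** * The atoms of [gpA] as translates of subgroups *)

Section Translation.
Variables (F : group_pair) (e : coset_enum F).
Implicit Types x y z : gpI F.

Definition gprel x y : gpG x -> gpG y -> Prop := iso_rel (gpH x y) (gpphi x y).

Definition elt x (p : gpG x) : gpU F := existT (fun x => gpG x : Type) x p.

Lemma elt_inj x : injective (@elt x).
Proof. by move=> p q; apply: existT_inj2. Qed.

(** Carries a relation between two groups to the disjoint union, where [gpA] lives, so that the
    computations can be done inside the groups. *)
Definition lift x y (P : gpG x -> gpG y -> Prop) : set (gpU F * gpU F) :=
  [set (elt u.1, elt u.2)
    | u in [set u | P u.1 u.2]].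

Lemma lift_in x y (P : gpG x -> gpG y -> Prop) p q :
  lift P (elt p, elt q) <-> P p q.
Proof.
split=> [[[p' q'] /= Ppq]|Ppq]; last by exists (p, q).
by move=> /pair_equal_spec [/elt_inj <- /elt_inj <-].
Qed.

Lemma lift_eq x y (P P' : gpG x -> gpG y -> Prop) :
  (forall p q, P p q <-> P' p q) -> lift P = lift P'.
Proof. by move=> PP'; apply/seteqP; split=> _ [u /= /PP' Pu <-]; exists u. Qed.

Lemma relcomp_lift x y z (P : gpG x -> gpG y -> Prop) (P' : gpG y -> gpG z -> Prop) :
  relcomp (lift P) (lift P') = lift (rcomp P P').
Proof.
apply/seteqP; split=> [[u w] [v /= [[p q] /= Pp Ev] [[q' r] /= Pr Ev']]|].
  case/pair_equal_spec: Ev => <- Ev; case/pair_equal_spec: Ev' => Ev' <-.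
  rewrite -Ev in Ev'; move/elt_inj: Ev' => Eq.
  by apply/lift_in; exists q => //; rewrite -Eq.
move=> _ [[p r] /= [q Pp Pr] <-].
by exists (elt q) => /=; apply/lift_in.
Qed.

Lemma gprel_goursat x y : gpE x y -> goursat (@gprel x y).
Proof.
move=> E; exact: goursat_iso_rel (gpH_normal _ _ _ E) (gpK_normal _ _ _ E)
  (gpphi_iso _ _ _ E).
Qed.

Lemma gprel_ker x y p : gpE x y -> gprel p (1 : gpG y) <-> gpH x y p.
Proof.
move=> E; exact: iso_rel_ker (gpH_normal _ _ _ E) (gpK_normal _ _ _ E)
  (gpphi_iso _ _ _ E) p.
Qed.

Lemma gprel1 x y q : gpE x y -> gprel (1 : gpG x) q <-> gpK x y q.
Proof.
move=> E; exact: iso_rel1 (gpH_normal _ _ _ E) (gpK_normal _ _ _ E)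
  (gpphi_iso _ _ _ E) q.
Qed.

Lemma enum_rep x y (a : enum_kappa e x y) : gpE x y ->
  exists h, enum_H e a = cprod [set h] (gpH x y).
Proof. by case/(enum_H_bij _ e) => /(_ a I) [h _ <-] _ _; exists h. Qed.

Lemma enum_of x y h : gpE x y ->
  exists a : enum_kappa e x y, enum_H e a = cprod [set h] (gpH x y).
Proof.
by case/(enum_H_bij _ e) => _ _ /(_ _ (cosets_lcoset _ h)) [a _ <-]; exists a.
Qed.

(** Over [p H], the set [K_c o K_a] is [phi(p H) o phi(h H)], which is [phi(p h H)]. *)
Lemma gpR_lift x y (a : enum_kappa e x y) h : gpE x y ->
  enum_H e a = cprod [set h] (gpH x y) ->
  gpR a = lift (fun p (q : gpG y) => gprel (p * h) q).
Proof.
move=> E Ea; have nH := gpH_normal _ _ _ E; have gP := gprel_goursat E.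
apply/seteqP; split=> [[_ _] [c _ [[p /= Hp <-] [q /= + <-]]]|].
  rewrite /enum_K Ea.
  have [g Ec] := enum_rep c E; rewrite Ec in Hp *.
  rewrite (lcoset_eq nH Hp) => -[k Pk [l Pl <-]].
  by apply/lift_in; exact: (goursatM gP) Pk Pl.
move=> _ [[p q] /= Ppq <-].
have [c Ec] := enum_of p E; exists c => //; split=> /=.
  by exists p => //; rewrite Ec; exact: lcoset_refl.
exists q => //; rewrite /enum_K Ea Ec.
(* Any [l] in [phi(h H)] splits [q] into [q * l^-1], which lies in [phi(p H)], and [l]. *)
have [l Pl] := goursat_total gP h.
exists (q * l^-1); last by exists l => //; rewrite mulgVK.
by have := goursatM gP Ppq (goursatV gP Pl); rewrite mulgK.
Qed.

Lemma gpR_zero x y : gpE x y -> gpR (enum_zero e x y) = lift (@gprel x y).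
Proof.
move=> E; rewrite (gpR_lift (h := 1) E); last by rewrite lcoset1 enum_H_zero.
by apply: lift_eq => p q; rewrite mulg1.
Qed.

(** Some atom of the union contains [(1, 1)]. Its indices must be [x] and [z], and its translating
    element [h] satisfies [gprel h 1], so this atom is the untranslated subgroup. *)
Lemma gprel_sub_of_gpA x z (Q : gpG x -> gpG z -> Prop) :
  goursat Q -> gpA e (lift Q) -> forall p r, gprel p r -> Q p r.
Proof.
move=> gQ [S SA] /seteqP [SQ QS] p r.
have /QS [R SR R11] : lift Q (elt (1 : gpG x), elt (1 : gpG z)).
  by apply/lift_in; exact: goursat1.
have [u [v [c [Euv ER]]]] := SA _ SR; subst R.
have [Exu Ezv] : u = x /\ v = z.
  case: R11 => d _ [[p' _ Ep] [r' _ Er]].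
  by split; [have := congr1 (@projT1 _ _) Ep|have := congr1 (@projT1 _ _) Er].
subst u v.
have [h Ec] := enum_rep c Euv.
have R_Q p' r' : gprel (p' * h) r' -> Q p' r'.
  move=> Ppr; apply/lift_in/SQ; exists (gpR c) => //.
  by rewrite (gpR_lift Euv Ec); apply/lift_in.
move: R11; rewrite (gpR_lift Euv Ec) => /lift_in; rewrite mul1g => Ph Ppr.
by apply: R_Q; apply/(goursat_ker (gprel_goursat Euv) Ph).
Qed.

Lemma lift_translate x z (Q : gpG x -> gpG z -> Prop) h :
  gpE x z -> goursat Q -> (forall p r, gprel p r -> Q p r) ->
  lift (fun p r => Q (p * h) r) =
  \bigcup_(c in [set c : enum_kappa e x z |
     exists2 g, enum_H e c = cprod [set g] (gpH x z) & Q (h^-1 * g) 1]) gpR c.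
Proof.
move=> E gQ PQ; apply/seteqP; split=> [_ [[p r] /= Qpr <-]|w].
  (* The translate of [gprel] by [p^-1 * p'] passes through [(p, r)]; since also [Q p' r], the
     elements [p^-1 * p'] and [h] agree modulo the kernel of [Q]. *)
  have [p' Pp'] := goursat_surj (gprel_goursat E) r.
  have [c Ec] := enum_of (p^-1 * p') E.
  exists c; last by rewrite (gpR_lift E Ec); apply/lift_in; rewrite mulVKg.
  exists (p^-1 * p') => //.
  rewrite mulgA -invgM; apply/(goursat_eqr gQ _ Qpr); exact: PQ.
move=> [c /= [g Ec Qg]]; rewrite (gpR_lift E Ec) => -[[p r] /= /PQ Qpr <-].
apply/lift_in/(goursat_eqr gQ _ Qpr).
rewrite invgM -mulgA mulKg.
by have := goursatV gQ Qg; rewrite invgM invgK invg1.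
Qed.

Lemma gpA_translate x z (Q : gpG x -> gpG z -> Prop) h :
  gpE x z -> goursat Q -> (forall p r, gprel p r -> Q p r) ->
  gpA e (lift (fun p r => Q (p * h) r)).
Proof.
move=> E gQ PQ; rewrite (lift_translate _ E gQ PQ).
set D := [set c | _].
exists [set gpR c | c in D]; last by rewrite bigcup_image.
by move=> _ [c _ <-]; exists x, z, c.
Qed.

(** * Composites of two atoms *)

Section Composition.
Variables x y z : gpI F.
Hypotheses (Exy : gpE x y) (Eyz : gpE y z).

Let Exz : gpE x z.
Proof. by have T := @Equivalence_Transitive _ _ (gpE_equiv F); exact: T Exy Eyz. Qed.

Let P := @gprel x y.
Let P' := @gprel y z.
Let Q := rcomp P P'.
Let gP : goursat P := gprel_goursat Exy.
Let gP' : goursat P' := gprel_goursat Eyz.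
Let gQ : goursat Q := goursat_comp gP gP'.

(** Since [P l k], translating the middle variable by [k] amounts to translating the left one by
    [l]; the two translations combine to [h * l]. *)
Lemma relcomp_gpR (a : enum_kappa e x y) (b : enum_kappa e y z) h k l :
  enum_H e a = cprod [set h] (gpH x y) -> enum_H e b = cprod [set k] (gpH y z) ->
  gprel l k ->
  relcomp (gpR a) (gpR b) = lift (fun p r => rcomp P P' (p * (h * l)) r).
Proof.
move=> Ea Eb Plk; rewrite (gpR_lift Exy Ea) (gpR_lift Eyz Eb) relcomp_lift.
apply: lift_eq => p r; rewrite mulgA; split=> [[q Pq P'q]|[q Pq P'q]].
  by exists (q * k) => //; exact: goursatM Pq Plk.
by exists (q * k^-1); rewrite ?mulgVK //; apply/(goursat_mul gP _ _ Plk); rewrite mulgVK.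
Qed.

(** [P a] is [phi_xy(a H_xy)], so the preimage is the left coset of [a * h] modulo the kernel of
    [Q]. If [P p q] and [q = s * t] in the product, compare [(p, q)] with [(a h, s k)]. *)
Lemma preimg_in a h k p : P h k ->
  phi_preimg x y (cprod (P a) (cprod [set k] (gpH y z))) p <->
  Q ((a * h)^-1 * p) 1.
Proof.
move=> Phk; have nH := gpH_normal _ _ _ Exy; split.
  case=> C [cC sub] Cp.
  have [q Pq] := goursat_total gP p.
  have [|s Ps [t /lcosetE /(gprel_ker _ Eyz) Ht Eq]] := sub q.
    by rewrite (cosetsP nH cC Cp).
  exists (k^-1 * t) => //.
  have := goursatM gP (goursatV gP (goursatM gP Ps Phk)) Pq.
  by rewrite -Eq (invgM s) -mulgA mulKg.
move=> [t Pt P't]; exists (cprod [set p] (gpH x y)); last exact: lcoset_refl.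
split; first exact: cosets_lcoset.
(* Split [q] at [k * t]: dividing [(p, q)] by the product of [(h, k)] and [((a h)^-1 p, t)] leaves
   the first entry [a]. *)
move=> q Pq; exists (q * (k * t)^-1); last first.
  exists (k * t); last by rewrite mulgVK.
  by apply/lcosetE; rewrite mulKg; apply/(gprel_ker _ Eyz).
have := goursatM gP Pq (goursatV gP (goursatM gP Phk Pt)).
by rewrite !invgM !mulgA !invgK mulgV mul1g mulgK.
Qed.

(** * The subgroup [M] and the induced maps *)

Lemma gpM_in p : gpM x y z p <-> Q p 1.
Proof.
have := @preimg_in 1 1 1 p (goursat1 gP).
rewrite mulg1 invg1 mul1g lcoset1 /gpM => <-.
by have -> : gpK x y = P 1 by apply/seteqP; split=> q /(gprel1 _ Exy).
Qed.

Lemma gpM_normal : normal_subgroup (gpM x y z).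
Proof.
have -> : gpM x y z = [set p | Q p 1] by apply/seteqP; split=> p /gpM_in.
exact: goursat_ker_normal.
Qed.

(** The middle subgroup is the image of [M] under [P]: an element of [gpH y z] lifts to some [m] in
    [M], and elements of [gpK x y] are related to [1]. *)
Lemma KH_in q : cprod (gpK x y) (gpH y z) q <-> exists2 m, P m q & Q m 1.
Proof.
split=> [[k /(gprel1 _ Exy) Pk [h /(gprel_ker _ Eyz) P'h <-]]|].
  have [m Pm] := goursat_surj gP h.
  by exists m; [have := goursatM gP Pk Pm; rewrite mul1g|exists h].
move=> [m Pm [h Ph P'h]]; exists (q * h^-1).
  by apply/(gprel1 _ Exy); have := goursatM gP Pm (goursatV gP Ph); rewrite mulgV.
by exists h; [apply/(gprel_ker _ Eyz)|rewrite mulgVK].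
Qed.

(** [phi_img] collects only the cosets inside [S]. Stability of [S] under [gpH u v] puts the whole
    coset of each of its points inside [S], so the image can be computed pointwise. *)
Lemma phi_img_in u v (S : set (gpG u)) : gpE u v ->
  (forall p h, S p -> gpH u v h -> S (p * h)) ->
  forall q, phi_img u v S q <-> exists2 p, S p & gprel p q.
Proof.
move=> E SH q; have nH := gpH_normal _ _ _ E.
split=> [[C [[p _ <-] sub] Pq]|[p Sp Pq]].
  by exists p => //; apply: sub; exact: lcoset_refl.
exists (cprod [set p] (gpH u v)) => //; split; first exact: cosets_lcoset.
by move=> p' /lcosetE /(SH _ _ Sp); rewrite mulVKg.
Qed.

Lemma img_M g q : P g q ->
  phi_img x y (cprod [set g] (gpM x y z)) =
  cprod [set q] (cprod (gpK x y) (gpH y z)).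
Proof.
move=> Pgq.
(* [H_xy] lies in [M], with middle element [1]; hence cosets of [M] are unions of cosets of
   [H_xy]. *)
have stab p h : cprod [set g] (gpM x y z) p -> gpH x y h ->
    cprod [set g] (gpM x y z) (p * h).
  rewrite !lcosetE mulgA => Mp /(gprel_ker _ Exy) Ph.
  by apply: (normalM gpM_normal Mp); apply/gpM_in; exists 1; last exact: goursat1.
apply/seteqP; split=> r.
  move=> /(phi_img_in Exy stab) [p /lcosetE /gpM_in Qp Pp].
  apply/lcosetE/KH_in; exists (g^-1 * p) => //.
  exact: (goursatM gP) (goursatV gP Pgq) Pp.
move=> /lcosetE /KH_in [m Pm Qm]; apply/(phi_img_in Exy stab).
exists (g * m); first by apply/lcosetE/gpM_in; rewrite mulKg.
by have := goursatM gP Pgq Pm; rewrite mulVKg.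
Qed.

Lemma img_KH g q : P g q ->
  phi_img y z (cprod [set q] (cprod (gpK x y) (gpH y z))) = Q g.
Proof.
move=> Pgq.
have stab p h : cprod [set q] (cprod (gpK x y) (gpH y z)) p -> gpH y z h ->
    cprod [set q] (cprod (gpK x y) (gpH y z)) (p * h).
  rewrite !lcosetE mulgA => -[k Kk [l Hl <-]] Hh; exists k => //.
  exists (l * h); last by rewrite mulgA.
  exact: normalM (gpH_normal _ _ _ Eyz) _ _ Hl Hh.
apply/seteqP; split=> r.
  move=> /(phi_img_in Eyz stab) [s /lcosetE /KH_in [m Pm Qm] P's].
  apply/(goursat_ker gQ Qm); exists s => //.
  by have := goursatM gP Pgq Pm; rewrite mulVKg.
move=> [s Ps P's]; apply/(phi_img_in Eyz stab); exists s => //.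
apply/lcosetE/KH_in; exists 1; last exact: goursat1.
by apply/(goursat_eql gP _ Pgq).
Qed.

Lemma relcomp_induced :
  relcomp (induced x y (gpM x y z)) (induced y z (cprod (gpK x y) (gpH y z))) =
  [set (cprod [set g] (gpM x y z), Q g : set (gpG z)) | g in [set: gpG x]].
Proof.
apply/seteqP; split=> [[C D] [E /= [_ [g _ <-] /pair_equal_spec [<- <-]]]|].
  have [q Pgq] := goursat_total gP g.
  rewrite (img_M Pgq) => -[_ [q' _ <-] /pair_equal_spec [-> <-]].
  by exists g => //; rewrite (img_KH Pgq).
move=> _ [g _ <-]; have [q Pgq] := goursat_total gP g.
exists (cprod [set q] (cprod (gpK x y) (gpH y z))) => /=.
  exists (cprod [set g] (gpM x y z)); first exact: cosets_lcoset.
  by rewrite (img_M Pgq).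
exists (cprod [set q] (cprod (gpK x y) (gpH y z))); first exact: cosets_lcoset.
by rewrite (img_KH Pgq).
Qed.

Lemma img_xz g r : gpH x z `<=` gpM x y z ->
  phi_img x z (cprod [set g] (gpM x y z)) r <->
  exists2 p, Q (g^-1 * p) 1 & gprel p r.
Proof.
move=> HM; rewrite phi_img_in //.
  by split=> -[p Qp Pp]; exists p => //; [move/lcosetE/gpM_in: Qp|apply/lcosetE/gpM_in].
move=> p h; rewrite !lcosetE mulgA => Mp /HM; exact: normalM gpM_normal _ _ Mp.
Qed.

Lemma induced_compE :
  induced_comp x y z <-> forall p r, gprel p r -> Q p r.
Proof.
rewrite /induced_comp relcomp_induced; split=> [[HM /seteqP [_ sub]] g r Pgr|PQ].
  have [] := sub (cprod [set g] (gpM x y z), phi_img x z (cprod [set g] (gpM x y z))).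
    by exists (cprod [set g] (gpM x y z)) => //; exact: cosets_lcoset.
  (* Equality of graphs yields only some representative [g'] of the coset [g M]; as [g'^-1 * g] is
     in the kernel of [Q], the fibres [Q g'] and [Q g] agree. *)
  move=> g' _ /pair_equal_spec [Eg Eimg].
  have Qg'g : Q (g'^-1 * g) 1.
    by apply/gpM_in/lcosetE; rewrite Eg; exact: lcoset_refl gpM_normal _.
  rewrite -[g](mulVKg g'); apply/(goursat_ker gQ Qg'g).
  rewrite Eimg; apply/(img_xz _ _ HM); exists g => //.
  by rewrite mulVg; exact: goursat1.
have HM : gpH x z `<=` gpM x y z.
  by move=> p /(gprel_ker _ Exz) /PQ /gpM_in.
split=> //.
have imgE g : phi_img x z (cprod [set g] (gpM x y z)) = Q g.
  apply/seteqP; split=> r.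
    move=> /(img_xz _ _ HM) [p Qp /PQ Qpr].
    by apply/(goursat_ker gQ Qp); rewrite mulVKg.
  (* A preimage [p] of [r] under [gprel] satisfies [Q p r] as well, so it differs from [g] by an
     element of [M]. *)
  move=> Qgr; have [p Pp] := goursat_surj (gprel_goursat Exz) r.
  apply/(img_xz _ _ HM); exists p => //.
  by apply/(goursat_eqr gQ _ Qgr)/PQ.
apply/seteqP; split=> _ [g Hg <-].
  by exists (cprod [set g] (gpM x y z)); [exact: cosets_lcoset|rewrite imgE].
by case: Hg => g' _ <-; exists g' => //; rewrite imgE.
Qed.

(** * Equivalence of the four conditions, and closure of [gpA] *)

Lemma relcomp_gpRE (PQ : forall p r, gprel p r -> Q p r)
    (a : enum_kappa e x y) (b : enum_kappa e y z) :
  relcomp (gpR a) (gpR b) =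
  \bigcup_(c in [set c : enum_kappa e x z |
      enum_H e c `<=` phi_preimg x y (cprod (enum_K a) (enum_H e b))]) gpR c.
Proof.
have [h Ea] := enum_rep a Exy; have [k Eb] := enum_rep b Eyz.
have [l Plk] := goursat_surj gP k.
rewrite (relcomp_gpR Ea Eb Plk) (lift_translate _ Exz gQ PQ).
(* The preimage is a coset of [M], and [H_xz] lies in [M] by [PQ]; so it contains a coset of [H_xz]
   as soon as it contains one representative. *)
congr bigcup; apply/seteqP; split=> c /=.
  move=> [g Ec Qg] p; rewrite Ec /enum_K Ea Eb => /lcosetE /(gprel_ker _ Exz) /PQ Qp.
  apply/(preimg_in _ _ Plk); have := goursatM gQ Qg Qp.
  by rewrite mulg1 -mulgA mulVKg.
have [g Ec] := enum_rep c Exz; rewrite Ec /enum_K Ea Eb => sub.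
exists g => //; apply/(preimg_in _ _ Plk)/sub.
exact: lcoset_refl (gpH_normal _ _ _ Exz) _.
Qed.

Lemma composition_equiv :
  [<-> gpA e (relcomp (gpR (enum_zero e x y)) (gpR (enum_zero e y z)));
       forall (a : enum_kappa e x y) (b : enum_kappa e y z),
         gpA e (relcomp (gpR a) (gpR b));
       forall (a : enum_kappa e x y) (b : enum_kappa e y z),
         relcomp (gpR a) (gpR b) =
         \bigcup_(c in [set c : enum_kappa e x z |
             enum_H e c `<=` phi_preimg x y (cprod (enum_K a) (enum_H e b))])
           gpR c;
       induced_comp x y z].
Proof.
have iP : gpA e (relcomp (gpR (enum_zero e x y)) (gpR (enum_zero e y z))) ->
    forall p r, gprel p r -> Q p r.
  by rewrite !gpR_zero // relcomp_lift; exact: gprel_sub_of_gpA.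
have iiP (PQ : forall p r, gprel p r -> Q p r)
    (a : enum_kappa e x y) (b : enum_kappa e y z) : gpA e (relcomp (gpR a) (gpR b)).
  have [h Ea] := enum_rep a Exy; have [k Eb] := enum_rep b Eyz.
  have [l Plk] := goursat_surj gP k.
  by rewrite (relcomp_gpR Ea Eb Plk); exact: gpA_translate.
tfae.
- by move=> /iP PQ a b; exact: iiP.
- by move=> /(_ (enum_zero e x y) (enum_zero e y z)) /iP PQ a b; exact: relcomp_gpRE.
(* At the zero indices (iii) displays the composite as a union of atoms, which is (i). *)
- move=> iii; apply/induced_compE/iP; rewrite iii.
  set D := [set c | _]; exists [set gpR c | c in D]; last by rewrite bigcup_image.
  by move=> _ [c _ <-]; exists x, z, c.
- by move=> /induced_compE PQ; exact: iiP.
Qed.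

End Composition.

Lemma gpA_closedP :
  (forall R S, gpA e R -> gpA e S -> gpA e (relcomp R S)) <->
  (forall x y z, gpE x y -> gpE y z -> induced_comp x y z).
Proof.
have atomA x y (a : enum_kappa e x y) : gpE x y -> gpA e (gpR a).
  move=> E; exists [set gpR a]; last by rewrite bigcup_set1.
  by move=> _ ->; exists x, y, a.
split=> [closed x y z Exy Eyz|ivP _ _ [S SA <-] [S' SA' <-]].
  (* The conditions are counted from zero: this is (i) implies (iv), applied to a composite of two
     atoms. *)
  apply: ((composition_equiv Exy Eyz) 0%N 3%N).1; apply: closed; exact: atomA.
(* The family of all atoms contained in the composite; it remains to place each pair of the
   composite in such an atom. *)
exists [set W | gpatoms e W /\ W `<=` relcomp (\bigcup_(R in S) R) (\bigcup_(R in S') R)].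
  by move=> W [].
apply/seteqP; split=> [w [W [_ sub] /sub]//|[u w] [v /= [R SR Ruv] [R' SR' R'vw]]].
have [x [y [a [Exy ER]]]] := SA _ SR; have [y' [z [b [Eyz ER']]]] := SA' _ SR'.
(* The common middle element [v] lies in only one group of the disjoint union. *)
have Ey : y = y'.
  move: Ruv R'vw; rewrite ER ER'.
  move=> [c _ [_ [q _ Eq]]] [d _ [[q' _ Eq'] _]].
  rewrite /= in Eq Eq'; rewrite -Eq' in Eq.
  by have := congr1 (@projT1 _ _) Eq.
subst y'.
have [T TA ET] := ((composition_equiv Exy Eyz) 3%N 1%N).1 (ivP _ _ _ Exy Eyz) a b.
have : relcomp (gpR a) (gpR b) (u, w) by exists v; rewrite /= -?ER -?ER'.
rewrite -ET => -[W TW Ww]; exists W => //; split; first exact: TA.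
move=> [s t] Wst; have : (\bigcup_(R in T) R) (s, t) by exists W.
rewrite ET -ER -ER' => -[m /= Rm R'm].
by exists m => /=; [exists R|exists R'].
Qed.

End Translation.

Theorem theorem3p10 (F : group_pair) (e : coset_enum F) :
  (forall x y z : gpI F, gpE x y -> gpE y z ->
     normal_subgroup (gpM x y z) /\
     [<-> gpA e (relcomp (gpR (enum_zero e x y)) (gpR (enum_zero e y z)));
          forall (a : enum_kappa e x y) (b : enum_kappa e y z),
            gpA e (relcomp (gpR a) (gpR b));
          forall (a : enum_kappa e x y) (b : enum_kappa e y z),
            relcomp (gpR a) (gpR b) =
            \bigcup_(c in [set c : enum_kappa e x z |
                enum_H e c `<=` phi_preimg x y (cprod (enum_K a) (enum_H e b))])
              gpR c;
          induced_comp x y z]) /\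
  ((forall R S, gpA e R -> gpA e S -> gpA e (relcomp R S)) <->
   (forall x y z : gpI F, gpE x y -> gpE y z -> induced_comp x y z)).
Proof.
split; last exact: gpA_closedP.
by move=> x y z Exy Eyz; split; [exact: gpM_normal|exact: composition_equiv].
Qed.
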